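(* Let $(J_1,J_2,W)$ be a pure bigraphon that is thin. Then (a) $W(x,y)\in\{0,1\}$ for almost every $(x,y)\in J_1\times J_2$; (b) the metric spaces $(J_1,r_1)$ and $(J_2,r_2)$ are compact; and (c) the metric spaces $(J_1,r_1)$ and $(J_2,r_2)$ have finite (upper) packing dimension.
   Context: A bigraphon is a triple $(J_1,J_2,W)$ where $J_1,J_2$ are standard probability spaces (with measures $\pi_1,\pi_2$) and $W:J_1\times J_2\to[0,1]$ is measurable. Its neighborhood distances are $r_1(x,y)=\int_{J_2}|W(x,z)-W(y,z)|\,dz$ for $x,y\in J_1$ and $r_2(x,y)=\int_{J_1}|W(z,x)-W(z,y)|\,dz$ for $x,y\in J_2$. The bigraphon is pure if for $i=1,2$, $r_i$ is defined for all pairs of points of $J_i$ and is a metric (in particular $r_i(x,y)>0$ for $x\ne y$), $(J_i,r_i)$ is a complete separable metric space, and the probability measure of $J_i$ (a measure on the Borel sets) has full support, i.e. every nonempty open set has positive measure. A bigraph is a triple $F=(U_1,U_2,E)$ with $U_1,U_2$ finite sets and $E\subseteq U_1\times U_2$. Its induced density in $W$ is $t^{\sf b}_{\rm ind}(F,W)=\int_{J_1^{U_1}}\int_{J_2^{U_2}}\prod_{(i,j)\in E}W(x_i,y_j)\prod_{(i,j)\in (U_1\times U_2)\setminus E}(1-W(x_i,y_j))\,dy\,dx$. The bigraphon is thin if $t^{\sf b}_{\rm ind}(F,W)=0$ for some bigraph $F$. The (upper) packing dimension of a metric space $(M,d)$ is $\limsup_{\varepsilon\to0}\log N(\varepsilon)/\log(1/\varepsilon)$,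 where $N(\varepsilon)$ is the maximum number of points of $M$ mutually at distance at least $\varepsilon$. *)

(* Defs.v *)
From HB Require Import structures.
From mathcomp Require Import all_boot all_order all_algebra finmap.
From mathcomp Require Import all_classical all_reals all_analysis.

Set Implicit Arguments.
Unset Strict Implicit.
Unset Printing Implicit Defensive.

Import Order.TTheory GRing.Theory Num.Theory.
Import numFieldNormedType.Exports.

Local Open Scope classical_set_scope.
Local Open Scope ring_scope.

Record is_metric (R : realType) (T : Type) (r : T -> T -> R) : Prop := IsMetric {
  is_metricxx : forall x, r x x = 0 ;
  is_metric_positivity : forall x y, r x y = 0 -> x = y ;
  is_metric_sym : forall x y, r x y = r y x ;
  is_metric_triangle : forall y x z, r x z <= r x y + r y z
}.

(* [T] with the metric, the uniformity and the topology induced by [r]. *)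
Definition metric_space (R : realType) (T : pointedType) (r : T -> T -> R)
  (rM : is_metric r) : Type := T.

Section metric_space_instances.
Context (R : realType) (T : pointedType) (r : T -> T -> R) (rM : is_metric r).

HB.instance Definition _ := Pointed.copy (metric_space rM) T.
HB.instance Definition _ := @isMetric.Build R (metric_space rM) r
  (is_metricxx rM) (is_metric_positivity rM) (is_metric_sym rM)
  (is_metric_triangle rM).

End metric_space_instances.

(* Same condition as in the library's [completeType]. *)
Definition complete (M : uniformType) : Prop :=
  forall F : set_system M, ProperFilter F -> cauchy F -> exists x : M, F --> x.

Definition separable (M : topologicalType) : Prop :=
  exists2 D : set M, countable D & dense D.

Section metric_measurable_space.
Context (R : realType) (d : measure_display) (T : measurableType d).

Definition measurable_is_borel (r : T -> T -> R) (rM : is_metric r) : Prop :=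
  forall A : set T,
    measurable A <-> <<s [set U : set (metric_space rM) | open U] >> A.

(* A standard probability space is a probability measure on such a [T]. *)
Definition standard_borel : Prop :=
  exists r : T -> T -> R, exists rM : is_metric r,
    [/\ complete (metric_space rM), separable (metric_space rM)
      & measurable_is_borel rM].

End metric_measurable_space.

Arguments standard_borel R {d} T.

(* The maximum number of points at mutual distance at least [e], with value
   +oo if there are arbitrarily large finite sets of such points. *)
Definition packing_number (R : realType) (M : metricType R) (e : R) : \bar R :=
  ereal_sup [set (#|` A|%:R)%:E | A in [set A : {fset M} |
    forall x y, x \in A -> y \in A -> x != y -> e <= mdist x y]].

Definition packing_dimension (R : realType) (M : metricType R) : \bar R :=
  limf_esup (fun e : R => (lne (packing_number M e) / (ln e^-1)%:E)%E) 0^'+.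

(* The product measure P^n on T^n, whose sigma-algebra is the one generated by
   the coordinates. *)
Section power_probability.
Context (R : realType) (d : measure_display) (T : measurableType d).
Variable P : probability T R.

Definition tuple_cons (n : nat) (p : T * n.-tuple T) : n.+1.-tuple T :=
  [tuple of p.1 :: p.2].

Lemma measurable_tuple_cons n : measurable_fun setT (@tuple_cons n).
Proof. exact: measurable_cons. Qed.

HB.instance Definition _ n :=
  isMeasurableFun.Build _ _ _ _ (@tuple_cons n) (@measurable_tuple_cons n).

Fixpoint power_probability (n : nat) : probability (n.-tuple T) R :=
  match n with
  | 0 => \d_([tuple] : 0.-tuple T)
  | m.+1 => distribution (P \x power_probability m)%E (@tuple_cons m)
  end.

End power_probability.

Section bigraphon.
Context (R : realType) (d1 d2 : measure_display).
Context (J1 : measurableType d1) (J2 : measurableType d2).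
Variables (P1 : probability J1 R) (P2 : probability J2 R) (W : J1 -> J2 -> R).

Record is_bigraphon : Prop := IsBigraphon {
  bigraphon_standard1 : standard_borel R J1 ;
  bigraphon_standard2 : standard_borel R J2 ;
  bigraphon_measurable : measurable_fun setT (fun p : J1 * J2 => W p.1 p.2) ;
  bigraphon_itv : forall x y, 0 <= W x y <= 1
}.

Definition nbhd_dist1 (x y : J1) : R := \int[P2]_z `|W x z - W y z|.
Definition nbhd_dist2 (x y : J2) : R := \int[P1]_z `|W z x - W z y|.

Record is_pure_side (d : measure_display) (J : measurableType d)
    (P : probability J R) (r : J -> J -> R) : Prop := IsPureSide {
  pure_metric : is_metric r ;
  pure_complete : complete (metric_space pure_metric) ;
  pure_separable : separable (metric_space pure_metric) ;
  pure_borel : measurable_is_borel pure_metric ;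
  pure_full_support : forall U : set (metric_space pure_metric),
    open U -> U !=set0 -> (0 < P U)%E
}.

(* The integrability conditions say that the distances are defined for all
   pairs of points. *)
Record is_pure : Prop := IsPure {
  pure_defined1 : forall x y : J1,
    P2.-integrable setT (fun z => `|W x z - W y z|%:E) ;
  pure_defined2 : forall x y : J2,
    P1.-integrable setT (fun z => `|W z x - W z y|%:E) ;
  pure_side1 : is_pure_side P1 nbhd_dist1 ;
  pure_side2 : is_pure_side P2 nbhd_dist2
}.

End bigraphon.

Definition pure_space (R : realType) (d : measure_display)
    (J : measurableType d) (P : probability J R) (r : J -> J -> R)
    (h : is_pure_side P r) : metricType R :=
  metric_space (pure_metric h).

Record bigraph := Bigraph {
  bigraph_left : finType ;
  bigraph_right : finType ;
  bigraph_edges : {set bigraph_left * bigraph_right}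
}.

Section induced_density.
Context (R : realType) (d1 d2 : measure_display).
Context (J1 : measurableType d1) (J2 : measurableType d2).
Variables (P1 : probability J1 R) (P2 : probability J2 R) (W : J1 -> J2 -> R).

(* A point of J^U is represented by a tuple, indexed through [enum_rank]. *)
Definition ind_density (F : bigraph) : R :=
  \int[power_probability P1 #|bigraph_left F|]_x
  \int[power_probability P2 #|bigraph_right F|]_y
    ((\prod_(e in bigraph_edges F)
        W (tnth x (enum_rank e.1)) (tnth y (enum_rank e.2))) *
     (\prod_(e in ~: bigraph_edges F)
        (1 - W (tnth x (enum_rank e.1)) (tnth y (enum_rank e.2))))).

Definition is_thin : Prop := exists F : bigraph, ind_density F = 0.

End induced_density.

(* Main.v *)
(* Write the density of F as the integral over x in J1^a of the product over the
   columns j of [column_density x j], the measure of the column pattern j of F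
   on x. Each column density is Lipschitz in x for the neighborhood distance and
   P1 has full support, so if the density vanishes, then EVERY a-tuple x has a
   column of density zero. For a constant tuple this says that W(x, .) is 0-1
   valued almost everywhere. Now let N points of J1 be at mutual distance at
   least e. Greedily, O(log N / e) points y outside a suitable null set separate
   them; if N were larger than the Sauer-Shelah bound, b of these y would be
   shattered, which yields an a-tuple with no null column. Hence N is polynomial
   in 1/e. Fubini's theorem exchanges the roles of J1 and J2. *)

Require Import Defs.
From mathcomp Require Import all_boot all_order all_algebra finmap.
From mathcomp Require Import all_classical all_reals all_analysis.
From mathcomp Require Import measurable_realfun.
From mathcomp Require Import ring lra.

Set Implicit Arguments.
Unset Strict Implicit.
Unset Printing Implicit Defensive.

Import Order.TTheory GRing.Theory Num.Theory.
Import numFieldNormedType.Exports.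

Local Open Scope ring_scope.

(** * Combinatorics of 0-1 matrices: shattering and separation *)

(* [S] splits into a set [S0 :|: (S1 :\: T1)] of representatives for the traces on
   the tail of [s], and the set [T1] of the points of [S] whose trace also occurs
   with the opposite value at the head. *)
Lemma sauer_shelah_dual (I : finType) (Y : eqType) (f : I -> Y -> bool)
    (s : seq Y) (b : nat) (S : {set I}) :
    {in S &, injective (fun i => [seq f i y | y <- s])} ->
    ((size s).+1 ^ b < #|S|)%N ->
  exists2 t : 'I_b -> Y, (forall j, t j \in s) &
    forall E : 'I_b -> bool, exists2 i, i \in S & forall j, f i (t j) = E j.
Proof.
elim: s b S => [|y s IHs] b S injf.
  rewrite exp1n => /card_gt1P[i [j [iS jS]]].
  by rewrite (injf i j iS jS erefl) eqxx.
case: b => [|b] ltS.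
  have /card_gt0P[i iS] : (0 < #|S|)%N by apply: leq_ltn_trans ltS.
  by exists (fun=> y) => [[]//|E]; exists i => // -[].
pose tr i := [seq f i z | z <- s].
pose S0 := [set i in S | ~~ f i y].
pose S1 := [set i in S | f i y].
pose T1 := [set i in S1 | [exists j in S0, tr j == tr i]].
have injS i j : i \in S -> j \in S -> f i y = f j y -> tr i = tr j -> i = j.
  by move=> iS jS fij trij; apply: injf => //=; rewrite fij; congr (_ :: _).
have SE : S = (S0 :|: (S1 :\: T1)) :|: T1.
  by apply/setP => i; rewrite !inE; case: (i \in S); case: (f i y) => //=;
    case: [exists _ in _, _].
have [lt1|le1] := ltnP ((size s).+1 ^ b.+1) #|S0 :|: (S1 :\: T1)|.
  have /IHs /(_ lt1)[t ts tE] : {in S0 :|: (S1 :\: T1) &, injective tr}.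
    have out i j : i \in S0 -> j \in S1 :\: T1 -> tr i = tr j -> False.
      move=> iS0 /setDP[jS1]; rewrite inE jS1 /= => /negP + trij; apply.
      by apply/exists_inP; exists i => //; rewrite trij.
    move=> i j /setUP[iS|iS] /setUP[jS|jS] trij.
    - by move: iS jS; rewrite !inE => /andP[iS /negPf fi] /andP[jS /negPf fj];
        apply: injS; rewrite // fi fj.
    - by case: (out i j).
    - by case: (out j i).
    - by move: iS jS; rewrite !inE => /and3P[_ iS fi] /and3P[_ jS fj];
        apply: injS; rewrite // fi fj.
  exists t => [j|E]; first by rewrite inE ts orbT.
  by have [i iS fE] := tE E; exists i => //; rewrite SE inE iS.
have : ((size s).+1 ^ b < #|T1|)%N.
  rewrite ltnNge; apply/negP => leT; move: ltS; apply/negP; rewrite -leqNgt.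
  rewrite SE; apply: (leq_trans (leq_card_setU _ _)).
  apply: (leq_trans (leq_add le1 leT)).
  (* With [m = size s], the two bounds add up to [(m+1)^b * (m+2)], which is at most
     [(m+2)^(b+1)]. *)
  rewrite /= !expnS -mulSnr.
  by rewrite leq_mul//; case: b {le1 leT IHs} => // b; rewrite leq_exp2r.
move=> /IHs[i j|t ts tE].
  rewrite !inE => /andP[/andP[iS fi] _] /andP[/andP[jS fj] _].
  by apply: injS; rewrite // fi fj.
exists (fun k => oapp t y (unlift ord0 k)) => [j|E].
  by case: unliftP => [k _|_]; rewrite inE /= ?ts ?orbT ?eqxx.
have [i] := tE (fun j => E (lift ord0 j)).
rewrite !inE => /andP[/andP[iS fi] /exists_inP[j]].
rewrite !inE => /andP[jS fj] /eqP trji fE.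
(* The rows [i] and [j] have the same trace on [s], but [i] has the value true at [y] and [j] the
   value false, so either value at the new coordinate can be realized. *)
exists (if E ord0 then i else j) => [|k]; first by case: ifP.
case: unliftP => [l ->|->] /=; last by case: ifP => // _; apply/negbTE.
case: ifP => _ //; rewrite -fE.
by move/eq_in_map : trji; apply.
Qed.

(** Apply the hypothesis to the set of pairs not yet separated: each new point of [G] leaves at most
    a fraction [1 - e] of them. Once the final bound drops below 1, all pairs are separated. *)
Lemma greedy_separation (R : realFieldType) (I : finType) (Y : eqType)
    (f : I -> Y -> bool) (G : Y -> Prop) (e : R) (e1 : e <= 1) :
    (forall Q : {set I * I}, (0 < #|Q|)%N -> (forall p, p \in Q -> p.1 != p.2) ->
      exists2 y, G y & e * #|Q|%:R <= #|[set p in Q | f p.1 y != f p.2 y]|%:R) ->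
  forall k, exists s : seq Y, [/\ (size s <= k)%N, forall y, y \in s -> G y &
    #|[set p : I * I | (p.1 != p.2) &&
        ([seq f p.1 y | y <- s] == [seq f p.2 y | y <- s])]|%:R
    <= (1 - e) ^+ k * #|I|%:R ^+ 2].
Proof.
move=> sep; elim=> [|k [s [sk sG]]].
  exists [::]; split => //; rewrite expr0 mul1r -natrX ler_nat.
  by rewrite -mulnn -card_prod max_card.
set Q := finset _ => leQ.
have [Q0|Qn0] := posnP #|Q|.
  exists s; split => //; first exact: leqW.
  by rewrite -/Q Q0 mulr_ge0 ?exprn_ge0 ?subr_ge0 ?ler0n.
have [p|y Gy leS] := sep Q Qn0; first by rewrite inE => /andP[].
exists (y :: s); split => //.
  by move=> z; rewrite inE => /predU1P[->|/sG].
set Q' := finset _.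
have QE : (#|Q| = #|Q'| + #|[set p in Q | f p.1 y != f p.2 y]|)%N.
  rewrite -(cardsID [set p | f p.1 y != f p.2 y] Q) addnC; congr (_ + _)%N.
    apply: eq_card => p; rewrite !inE /= eqseq_cons negbK.
    by rewrite [RHS]andbCA.
  by apply: eq_card => p; rewrite !inE.
have -> : #|Q'|%:R = #|Q|%:R - #|[set p in Q | f p.1 y != f p.2 y]|%:R :> R.
  by rewrite QE natrD addrK.
rewrite exprS -mulrA; apply: (@le_trans _ _ ((1 - e) * #|Q|%:R)).
  by rewrite mulrBl mul1r lerB.
by rewrite ler_wpM2l// subr_ge0.
Qed.

(** Makes the implicit bound on [N] explicit. Taking [k] close to [2 ln N / e] gives
    [ln N <= b ln (k + 1)], whose right side involves [N] only through [ln (ln N)]; that term is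
    absorbed on the left. *)
Lemma ln_le_of_pow_bound (R : realType) (N b : nat) (e : R) :
    (0 < N)%N -> 0 < e -> e <= 1 ->
    (forall k, (1 - e) ^+ k * N%:R ^+ 2 < 1 -> (N <= k.+1 ^ b)%N) ->
  ln N%:R <= 1 + 2 * b.+1%:R * ln (4 * b.+1%:R) + 2 * b.+1%:R * ln e^-1.
Proof.
move=> N0 e0 e1 H.
have NR0 : 0 < N%:R :> R by rewrite ltr0n.
have L0 : 0 <= ln N%:R :> R by rewrite ln_ge0 // ler1n.
set L := ln N%:R in L0 *.
(* Using [b.+1] for [b] keeps the later division by [4 * B] meaningful when [b = 0]. *)
set B : R := b.+1%:R; have B1 : 1 <= B by rewrite ler1n.
(* This choice of [k] makes [(1 - e) ^+ k <= expR (- e * k) < N ^- 2]. *)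
set x := 2 * L / e; have x0 : 0 <= x by rewrite divr_ge0 ?mulr_ge0 // ltW.
pose k := (Num.truncn x).+1.
have kx : x < k%:R by rewrite truncnS_gt.
have xk : k%:R <= x + 1 by rewrite /k -addn1 natrD lerD2r truncn_le.
have /H : (1 - e) ^+ k * N%:R ^+ 2 < 1.
  have le1 : (1 - e) ^+ k <= expR (k%:R * - e).
    by rewrite expRM_natl lerXn2r ?nnegrE ?expR_ge0 ?subr_ge0 // expR_ge1Dx.
  apply: (le_lt_trans (ler_wpM2r _ le1)); first by rewrite exprn_ge0 // ltW.
  have -> : N%:R ^+ 2 = expR (2 * L) by rewrite expRM_natl lnK.
  rewrite -expRD -[ltRHS]expR0 ltr_expR.
  move: kx; rewrite /x ltr_pdivrMr //.
  by rewrite mulrN addrC subr_lt0.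
rewrite -(ler_nat R) natrX => leN.
have leL : L <= B * ln k.+1%:R.
  apply: (@le_trans _ _ (ln (k.+1%:R ^+ b))).
    by rewrite ler_ln ?posrE ?exprn_gt0.
  by rewrite lnXn // -[leLHS]mulr_natl ler_wpM2r ?ln_ge0 ?ler1n // ler_nat.
have lek : ln k.+1%:R <= ln (2 * L + 2) + ln e^-1 :> R.
  have p0 : 0 < 2 * L + 2 by lra.
  rewrite -lnM ?posrE ?invr_gt0 // ler_ln ?posrE ?divr_gt0 //.
  rewrite ler_pdivlMr // -natr1.
  have xe : x * e = 2 * L by rewrite divfK ?gt_eqF.
  have : (k%:R + 1) * e <= (x + 2) * e by rewrite ler_wpM2r //; lra.
  by rewrite [leRHS]mulrDl xe; lra.
(* [ln v <= v] at [v = u / (4 B)] leaves only half of [L] on the right. *)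
have leu : ln (2 * L + 2) <= (2 * L + 2) / (4 * B) + ln (4 * B).
  have p0 : 0 < (2 * L + 2) / (4 * B) by rewrite divr_gt0; lra.
  have B4 : 0 < 4 * B by lra.
  have uE : (2 * L + 2) / (4 * B) * (4 * B) = 2 * L + 2.
    by rewrite divfK ?gt_eqF.
  by rewrite -{1}uE lnM ?posrE // lerD2r ltW // ln_sublinear.
have : B * ln k.+1%:R <= B * ((2 * L + 2) / (4 * B) + ln (4 * B) + ln e^-1).
  rewrite ler_wpM2l ?(le_trans ler01) //.
  by apply: (le_trans lek); rewrite lerD2r.
have -> : B * ((2 * L + 2) / (4 * B) + ln (4 * B) + ln e^-1) =
  (L + 1) / 2 + B * ln (4 * B) + B * ln e^-1 by field; lra.
lra.
Qed.

Local Open Scope classical_set_scope.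

(** * Packing bounds, compactness and packing dimension *)

Definition packing_separated (R : realType) (M : metricType R) (e : R) (A : {fset M}) :=
  forall x y, x \in A -> y \in A -> x != y -> e <= mdist x y.

(** Take an ultrafilter and an [e]-separated set of maximal size. If no ball of radius [e] around
    its points were in the ultrafilter, the complements of these finitely many balls would share a
    point, which could be added to the set. So the ultrafilter contains balls of every radius, is
    Cauchy, and converges by completeness. *)
Lemma finite_packing_compact (R : realType) (M : metricType R) :
    complete M ->
    (forall e : R, 0 < e ->
      exists n, forall A : {fset M}, packing_separated e A -> (#|` A| <= n)%N) ->
  compact [set: M].
Proof.
move=> cM bdM; rewrite compact_ultra => F FU _.
suff cF : cauchy F by have [x Fx] := cM F _ cF; exists x.
apply: cauchy_exP => e e0.
have [n nP] := bdM e e0.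
pose P m := `[< exists2 A : {fset M}, packing_separated e A & #|` A| = m >].
have exP : exists m, P m.
  by exists 0%N; apply/asboolP; exists fset0 => //; rewrite cardfs0.
have leP m : P m -> (m <= n)%N by move=> /asboolP[A /nP + <-].
case: (ex_maxnP exP leP) => m /asboolP[A sA cA] maxA.
apply: contrapT => /forallNP noball.
have : F (\bigcap_(x in [set` A]) ~` ball x e).
  apply: filter_bigI => x _.
  by have [] := in_ultra_setVsetC (ball x e) FU => // /noball.
move=> /filter_ex[z zA].
have far x : x \in A -> e <= mdist x z.
  by move=> xA; have := zA x xA; rewrite /= ballEmdist /= => /negP; rewrite -leNgt.
have zNA : z \notin A.
  by apply/negP => /far; rewrite mdistxx leNgt e0.
have /maxA : P m.+1.
  apply/asboolP; exists (z |` A)%fset; last by rewrite cardfsU1 zNA cA.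
  move=> x y; rewrite !inE => /predU1P[->|xA] /predU1P[->|yA].
  - by rewrite eqxx.
  - by rewrite metric_sym => _; exact: far.
  - by move=> _; exact: far.
  - exact: sA.
by rewrite ltnn.
Qed.

(** The singleton of [x0] makes the packing number at least 1, so the quotient is nonnegative for
    small [e], which excludes [-oo]; the logarithmic bound excludes [+oo]. *)
Lemma packing_dimension_fin_num (R : realType) (M : metricType R) (x0 : M)
    (C K : R) :
    (forall (e : R) (A : {fset M}), 0 < e -> e <= 1 -> packing_separated e A ->
      (0 < #|` A|)%N -> ln #|` A|%:R <= C + K * ln e^-1) ->
  packing_dimension M \is a fin_num.
Proof.
move=> bdM; pose f (e : R) := (lne (packing_number M e) / (ln e^-1)%:E)%E.
(* Below [expR (-1)] the denominator exceeds 1, so the contribution of [C] to the quotient is at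
   most its absolute value. *)
have lnV_gt1 (e : R) : 0 < e -> e < expR (-1) -> 1 < ln e^-1.
  move=> e0 e1; rewrite lnV // ltrNr.
  by rewrite -(expRK (-1)) ltr_ln ?posrE ?expR_gt0.
have em1 : expR (-1) <= 1 :> R by rewrite -[leRHS]expR0 ler_expR; lra.
have fge0 (e : R) : 0 < e -> e < expR (-1) -> (0 <= f e)%E.
  move=> e0 e1; apply: mule_ge0; last first.
    by rewrite inve_ge0 lee_fin (le_trans ler01)// ltW// lnV_gt1.
  rewrite lne_ge0; apply: ereal_sup_ubound; exists [fset x0]%fset.
    by move=> x y; rewrite !inE => /eqP -> /eqP ->; rewrite eqxx.
  by rewrite cardfs1.
have fle (e : R) : 0 < e -> e < expR (-1) -> (f e <= (`|C| + `|K|)%:E)%E.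
  move=> e0 e1; have l1 := lnV_gt1 e e0 e1.
  have eN0 : ln e^-1 != 0 by rewrite gt_eqF //; lra.
  have le1 : (packing_number M e <= (expR (`|C| + `|K| * ln e^-1))%:E)%E.
    apply: ge_ereal_sup => _ [A sA <-]; rewrite lee_fin.
    have [->|A0] := posnP #|` A|; first exact: expR_ge0.
    rewrite -[leLHS]lnK ?posrE ?ltr0n // ler_expR.
    apply: (le_trans (bdM e A e0 _ sA A0)); first by apply: ltW; lra.
    apply: lerD; first exact: ler_norm.
    by apply: ler_wpM2r; [lra|exact: ler_norm].
  have pn1 : (1 <= packing_number M e)%E.
    apply: ereal_sup_ubound; exists [fset x0]%fset.
      by move=> x y; rewrite !inE => /eqP -> /eqP ->; rewrite eqxx.
    by rewrite cardfs1.
  have : (lne (packing_number M e) <= (`|C| + `|K| * ln e^-1)%:E)%E.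
    have -> : ((`|C| + `|K| * ln e^-1)%:E =
       lne (expR (`|C| + `|K| * ln e^-1))%:E)%E.
      by rewrite lne_EFin ?expR_gt0 // expRK.
    rewrite lee_lne ?in_itv //= ?leey ?andbT ?lee_fin ?expR_ge0 //.
    exact: le_trans pn1.
  rewrite /f => le2.
  rewrite inver (negPf eN0) lee_pdivrMr; last by lra.
  apply: (le_trans le2); rewrite -EFinM lee_fin mulrDl lerD2r.
  by rewrite ler_peMr // ltW.
have near0 : (0 : R)^'+ [set e : R | 0 < e < expR (-1)].
  near=> e => /=; apply/andP; split; near: e.
    exact: nbhs_right_gt.
  exact: nbhs_right_lt (expR_gt0 _).
rewrite fin_numElt; apply/andP; split.
  apply: (@lt_le_trans _ _ 0%E); first exact: ltNyr.
  rewrite /packing_dimension limf_esupE; apply: le_ereal_inf_tmp => _ [V FV <-].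
  have /filter_ex[e [Ve /andP[e0 e1]]] : (0 : R)^'+ (V `&` [set e : R | 0 < e < expR (-1)]).
    exact: filterI.
  by apply: le_ereal_sup_tmp; exists (f e); [exists e|exact: fge0].
apply: (@le_lt_trans _ _ (`|C| + `|K|)%:E); last exact: ltry.
rewrite /packing_dimension limf_esupE; apply: ge_ereal_inf.
exists (ereal_sup (f @` [set e | 0 < e < expR (-1)])).
  by exists [set e | 0 < e < expR (-1)].
by apply: ge_ereal_sup => _ [e /andP[e0 e1] <-]; exact: fle.
Unshelve. all: by end_near. Qed.

(** * Vanishing integrals and product measures *)

Section measure_auxiliary.
Context (R : realType) (d : measure_display) (T : measurableType d).
Variable P : probability T R.

Lemma integrable_itv01 (f : T -> R) :
  measurable_fun setT f -> (forall x, 0 <= f x <= 1) ->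
  P.-integrable setT (EFin \o f).
Proof.
move=> mf f01; apply: measurable_bounded_integrable => //.
  by rewrite ltey_eq fin_num_measure.
exists 1; split => // M M1 x _ /=; have /andP[f0 f1] := f01 x.
by rewrite ger0_norm // (le_trans f1) // ltW.
Qed.

Lemma ge0_ae_eq0 (f : T -> R) :
  measurable_fun setT f -> (forall x, 0 <= f x) ->
  (\int[P]_x (f x)%:E = 0)%E -> {ae P, forall x, f x = 0}.
Proof.
move=> mf f0 intf0.
have : ae_eq P setT (EFin \o f) (cst 0%E).
  apply/ae_eq_integral_abs => //; first exact/measurable_EFinP.
  by rewrite -[RHS]intf0; apply: eq_integral => x _; rewrite /= ger0_norm.
by apply: filterS => x /= /(_ I) [].
Qed.

(** Induction by Tonelli: the integral over the first coordinate splits off as a factor. It serves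
    both for the inner integral of a density and for products of indicators of neighborhoods. *)
Lemma power_prod_integral_gt0 (n : nat) (h : 'I_n -> T -> R) :
    (forall i, measurable_fun setT (h i)) -> (forall i x, 0 <= h i x) ->
    (forall i, (0 < \int[P]_x (h i x)%:E)%E) ->
  (0 < \int[power_probability P n]_t (\prod_i h i (tnth t i))%:E)%E.
Proof.
elim: n h => [|n IHn] h mh h0 hpos.
  under eq_integral do rewrite big_ord0.
  rewrite integral_cst // mul1e.
  by rewrite [X in (_ < X)%E](probability_setT (power_probability P 0)).
have mprod k (g : 'I_k -> T -> R) : (forall i, measurable_fun setT (g i)) ->
    measurable_fun setT (fun t : k.-tuple T => (\prod_i g i (tnth t i))%:E).
  move=> mg; apply/measurable_EFinP/measurable_prod => i _.
  exact: measurableT_comp (mg i) (measurable_tnth i).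
have prod0 k (g : 'I_k -> T -> R) (t : k.-tuple T) : (forall i x, 0 <= g i x) ->
    (0 <= (\prod_i g i (tnth t i))%:E)%E.
  by move=> g0; rewrite lee_fin prodr_ge0.
rewrite ge0_integral_distribution; [|exact: mprod|by move=> t; exact: prod0].
pose I := (\int[power_probability P n]_t
  (\prod_i h (lift ord0 i) (tnth t i))%:E)%E.
have I0 : (0 < I)%E by apply: (IHn (fun i => h (lift ord0 i))).
rewrite fubini_tonelli1; last 2 first.
- by apply: (measurableT_comp (mprod _ _ mh)); exact: measurable_tuple_cons.
- by move=> t; exact: prod0.
rewrite (eq_integral (fun x => (h ord0 x)%:E * I)%E).
  rewrite ge0_integralZr //; first exact: mule_gt0.
  - exact/measurable_EFinP.
  - by move=> x _; rewrite lee_fin.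
  - exact: ltW.
move=> x _; rewrite /fubini_F /= -ge0_integralZl_EFin //.
- apply: eq_integral => t _; rewrite -EFinM big_ord_recl /tuple_cons /=.
  by rewrite tnth0; congr (_ * _)%:E; apply: eq_bigr => i _; rewrite tnthS.
- by move=> t _; exact: (prod0 _ (fun i => h (lift ord0 i))).
- exact: (mprod _ (fun i => h (lift ord0 i))).
Qed.

End measure_auxiliary.

(** * Products of edge weights *)

Lemma norm_prod_sub_le (R : numDomainType) (I : Type) (s : seq I) (u v : I -> R) :
    (forall i, 0 <= u i <= 1) -> (forall i, 0 <= v i <= 1) ->
  `|\prod_(i <- s) u i - \prod_(i <- s) v i| <= \sum_(i <- s) `|u i - v i|.
Proof.
move=> u01 v01; elim: s => [|i s IHs]; first by rewrite !big_nil subrr normr0.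
rewrite !big_cons; set p := \prod_(_ <- _) u _ in IHs *.
set q := \prod_(_ <- _) v _ in IHs *.
(* Telescoping: one factor is exchanged at a time, and the remaining factors are at most 1 in
   absolute value. *)
have -> : u i * p - v i * q = (u i - v i) * p + v i * (p - q) by ring.
have norm_le1 (x : R) : 0 <= x <= 1 -> `|x| <= 1.
  by move=> /andP[x0 x1]; rewrite ger0_norm.
have p01 : 0 <= p <= 1 by rewrite prodr_ile1 ?prodr_ge0 // => j; case/andP: (u01 j).
apply: (le_trans (ler_normD _ _)); rewrite !normrM lerD //.
  by rewrite ler_piMr // norm_le1.
by rewrite (le_trans _ IHs) // ler_piMl // norm_le1.
Qed.

(** The factor of one pair, edge or non-edge; it merges the two products of [ind_density] into
    one. *)
Definition edge_weight (R : realType) (e : bool) (u : R) := if e then u else 1 - u.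

Lemma edge_weight_itv (R : realType) (e : bool) (u : R) :
  0 <= u <= 1 -> 0 <= edge_weight e u <= 1.
Proof. by case: e => //= /andP[]; rewrite /edge_weight; lra. Qed.

Lemma edge_weight_sub (R : realType) (e : bool) (u v : R) :
  `|edge_weight e u - edge_weight e v| = `|u - v|.
Proof.
case: e => //; rewrite /edge_weight distrC.
by congr `|_|; ring.
Qed.

(** * Column densities: continuity and positivity *)

Section bigraphon_densities.
Context (R : realType) (d1 d2 : measure_display).
Context (J1 : measurableType d1) (J2 : measurableType d2).
Variables (P1 : probability J1 R) (P2 : probability J2 R) (W : J1 -> J2 -> R).

(** The induced density of a bigraph on ordinals, with values in the extended reals so that Tonelli
    applies directly. *)
Definition ordinal_density (a b : nat) (E : 'I_a -> 'I_b -> bool) : \bar R :=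
  (\int[power_probability P1 a]_x \int[power_probability P2 b]_y
    (\prod_j \prod_i edge_weight (E i j) (W (tnth x i) (tnth y j)))%:E)%E.

(* The inner integral of [ordinal_density] is the product over [j] of
   [column_density x (E^~ j)]. *)
Definition column_density (a : nat) (x : 'I_a -> J1) (c : 'I_a -> bool) : \bar R :=
  (\int[P2]_y (\prod_i edge_weight (c i) (W (x i) y))%:E)%E.

Hypothesis mW : measurable_fun setT (fun p : J1 * J2 => W p.1 p.2).
Hypothesis W01 : forall x y, 0 <= W x y <= 1.

Local Notation r1 := (nbhd_dist1 P2 W).

Lemma measurable_edge_weight (d : measure_display) (T : measurableType d)
    (e : bool) (f : T -> R) :
  measurable_fun setT f -> measurable_fun setT (fun t => edge_weight e (f t)).
Proof. by move=> mf; case: e => //; exact: measurable_funB. Qed.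

Lemma measurable_bigraphon_section x : measurable_fun setT (W x).
Proof. exact: (measurable_fun_pair2 x mW). Qed.

Lemma measurable_column (a : nat) (x : 'I_a -> J1) (c : 'I_a -> bool) :
  measurable_fun setT (fun y => \prod_i edge_weight (c i) (W (x i) y)).
Proof.
apply: measurable_prod => i _.
exact/measurable_edge_weight/measurable_bigraphon_section.
Qed.

Lemma column_itv (a : nat) (x : 'I_a -> J1) (c : 'I_a -> bool) y :
  0 <= \prod_i edge_weight (c i) (W (x i) y) <= 1.
Proof.
have ew i := edge_weight_itv (c i) (W01 (x i) y).
rewrite prodr_ge0 /=; last by move=> i _; case/andP: (ew i).
by apply: prodr_ile1 => i _; exact: ew.
Qed.

Lemma column_density_ge0 (a : nat) (x : 'I_a -> J1) (c : 'I_a -> bool) :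
  (0 <= column_density x c)%E.
Proof.
by apply: integral_ge0 => y _; rewrite lee_fin; have /andP[] := column_itv x c y.
Qed.

Lemma column_density_fin_num (a : nat) (x : 'I_a -> J1) (c : 'I_a -> bool) :
  column_density x c \is a fin_num.
Proof.
apply: integrable_fin_num => //; apply: integrable_itv01.
  exact: measurable_column.
exact: column_itv.
Qed.

Lemma measurable_dist x x' : measurable_fun setT (fun y => `|W x y - W x' y|).
Proof.
apply: measurableT_comp => //.
by apply: measurable_funB; exact: measurable_bigraphon_section.
Qed.

Lemma nbhd_dist1E x x' : ((r1 x x')%:E = \int[P2]_y `|W x y - W x' y|%:E)%E.
Proof.
rewrite /nbhd_dist1 /Rintegral fineK //.
apply: integrable_fin_num => //.
apply: (@integrable_itv01 _ _ _ P2 (fun y => `|W x y - W x' y|)) => [|y].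
  exact: measurable_dist.
rewrite normr_ge0 /= ler_norml.
by have := W01 x y; have := W01 x' y; lra.
Qed.

Lemma column_density_lipschitz (a : nat) (x x' : 'I_a -> J1) (c : 'I_a -> bool) :
  (column_density x c <= column_density x' c + (\sum_i r1 (x i) (x' i))%:E)%E.
Proof.
rewrite -sumEFin; under eq_bigr do rewrite nbhd_dist1E.
have mdist i : measurable_fun setT (fun y => `|W (x i) y - W (x' i) y|%:E).
  exact/measurable_EFinP/measurable_dist.
have mcol (z : 'I_a -> J1) :
    measurable_fun setT (fun y => (\prod_i edge_weight (c i) (W (z i) y))%:E).
  exact/measurable_EFinP/measurable_column.
have col0 (z : 'I_a -> J1) y : (0 <= (\prod_i edge_weight (c i) (W (z i) y))%:E)%E.
  by rewrite lee_fin; have /andP[] := column_itv z c y.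
rewrite -ge0_integral_sum // -ge0_integralD //; last 2 first.
- by move=> y _; apply: sume_ge0.
- exact: emeasurable_sum.
apply: ge0_le_integral => //.
  by apply: emeasurable_funD => //; exact: emeasurable_sum.
move=> y _; rewrite sumEFin -EFinD lee_fin -lerBlDl.
apply: (le_trans (ler_norm _)).
apply: (le_trans (norm_prod_sub_le _ _ _)) => [i|i|].
- exact: edge_weight_itv.
- exact: edge_weight_itv.
by apply: ler_sum => i _; rewrite edge_weight_sub.
Qed.

Lemma measurable_ordinal_integrand (a b : nat) (E : 'I_a -> 'I_b -> bool) :
  measurable_fun setT (fun p : a.-tuple J1 * b.-tuple J2 =>
    (\prod_j \prod_i edge_weight (E i j) (W (tnth p.1 i) (tnth p.2 j)))%:E).
Proof.
apply/measurable_EFinP/measurable_prod => j _.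
apply/measurable_prod => i _; apply/measurable_edge_weight.
have mp : measurable_fun setT
    (fun p : a.-tuple J1 * b.-tuple J2 => (tnth p.1 i, tnth p.2 j)); last first.
  exact: (measurableT_comp mW mp).
apply: measurable_fun_pair.
  exact: (measurableT_comp (measurable_tnth i) measurable_fst).
exact: (measurableT_comp (measurable_tnth j) measurable_snd).
Qed.

Lemma ordinal_integrand_ge0 (a b : nat) (E : 'I_a -> 'I_b -> bool)
    (x : a.-tuple J1) (y : b.-tuple J2) :
  (0 <= (\prod_j \prod_i edge_weight (E i j) (W (tnth x i) (tnth y j)))%:E)%E.
Proof.
rewrite lee_fin prodr_ge0 // => j _.
by have /andP[] := column_itv (tnth x) (E^~ j) (tnth y j).
Qed.

Lemma measurable_inner_density (a b : nat) (E : 'I_a -> 'I_b -> bool) :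
  measurable_fun setT (fun x : a.-tuple J1 => \int[power_probability P2 b]_y
    (\prod_j \prod_i edge_weight (E i j) (W (tnth x i) (tnth y j)))%:E)%E.
Proof.
apply: (measurable_fun_fubini_tonelli_F (fun p : a.-tuple J1 * b.-tuple J2 =>
  (\prod_j \prod_i edge_weight (E i j) (W (tnth p.1 i) (tnth p.2 j)))%:E)).
  exact: measurable_ordinal_integrand.
by move=> p; exact: ordinal_integrand_ge0.
Qed.

Section full_support.
Hypothesis pureP : is_pure_side P1 r1.

Lemma column_density_nbhd_gt0 (a : nat) (x : 'I_a -> J1) (c : 'I_a -> bool) :
    (0 < column_density x c)%E ->
  exists2 e : R, 0 < e &
    forall x', (forall i, r1 (x i) (x' i) < e) -> (0 < column_density x' c)%E.
Proof.
move=> cpos; have cfin := column_density_fin_num x c.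
(* By the Lipschitz bound the density drops by at most [a] times this radius; the denominator [a.+1]
   makes that strictly less than the density, also for [a = 0]. *)
exists (fine (column_density x c) / a.+1%:R).
  by rewrite divr_gt0 // fine_gt0 // cpos ltey_eq cfin.
move=> x' close; rewrite ltNge; apply/negP => c'le.
have := column_density_lipschitz x x' c; apply/negP; rewrite -ltNge.
apply: (@le_lt_trans _ _ ((\sum_i r1 (x i) (x' i))%:E)).
  by rewrite -[leRHS]add0e leeD2r.
rewrite -[ltRHS]fineK // lte_fin.
apply: (@le_lt_trans _ _ (\sum_(i < a) fine (column_density x c) / a.+1%:R)).
  by apply: ler_sum => i _; exact: ltW.
rewrite sumr_const card_ord -[ltLHS]mulr_natr -mulrA gtr_pMr; last first.
  by rewrite fine_gt0 // cpos ltey_eq cfin.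
by rewrite mulrC ltr_pdivrMr // mul1r ltr_nat.
Qed.

(** A single tuple with positive columns suffices: positivity persists on a product of neighborhoods
    of its coordinates, and full support gives each neighborhood positive measure. *)
Lemma ordinal_density_gt0 (a b : nat) (E : 'I_a -> 'I_b -> bool) (x : 'I_a -> J1) :
  (forall j, (0 < column_density x (E^~ j))%E) -> (0 < ordinal_density E)%E.
Proof.
move=> cpos.
have /choice[e eP] : forall j, exists e : R, 0 < e /\ forall x',
    (forall i, r1 (x i) (x' i) < e) -> (0 < column_density x' (E^~ j))%E.
  by move=> j; have [e e0 eP] := column_density_nbhd_gt0 (cpos j); exists e.
pose e0 := \big[Order.min/1]_j e j.
have e0_gt0 : 0 < e0 by apply: lt_bigmin => // j _; case: (eP j).
(* Interiors of balls are open, hence measurable by [pure_borel] and subject to full support. *)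
pose U i : set (metric_space (pure_metric pureP)) :=
  interior (ball (x i : metric_space (pure_metric pureP)) e0).
have oU i : open (U i) by exact: open_interior.
have Ux i : U i (x i) by exact: nbhsx_ballx.
have mU i : measurable (U i : set J1).
  by apply/(pure_borel pureP); apply: sub_sigma_algebra; exact: oU.
have PU i : (0 < P1 (U i))%E.
  by apply: (pure_full_support (oU i)); exists (x i).
pose F (t : a.-tuple J1) := (\int[power_probability P2 b]_y
  (\prod_j \prod_i edge_weight (E i j) (W (tnth t i) (tnth y j)))%:E)%E.
have F0 t : (0 <= F t)%E.
  by apply: integral_ge0 => y _; exact: ordinal_integrand_ge0.
have mF : measurable_fun setT F by exact: measurable_inner_density.
have Fpos (t : a.-tuple J1) : (forall i, U i (tnth t i)) -> (0 < F t)%E.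
  move=> tU; apply: (power_prod_integral_gt0 (h := fun j y =>
      \prod_i edge_weight (E i j) (W (tnth t i) y))) => [j|j y|j].
  - exact: measurable_column.
  - by have /andP[] := column_itv (tnth t) (E^~ j) y.
  - have [_] := eP j; apply => i.
    apply: (@lt_le_trans _ _ e0).
      by have := interior_subset (tU i); rewrite ballEmdist.
    exact: bigmin_le.
have dge0 : (0 <= ordinal_density E)%E by apply: integral_ge0 => t _; exact: F0.
rewrite lt_neqAle dge0 andbT eq_sym; apply/eqP => dens0.
have : (0 < \int[power_probability P1 a]_t (\prod_i \1_(U i) (tnth t i))%:E)%E.
  apply: (power_prod_integral_gt0 (h := fun i => \1_(U i : set J1))) => i //.
  by rewrite (integral_indic _ measurableT (mU i)) setIT; exact: PU.
apply/negP; rewrite -leNgt -(integral0 (power_probability P1 a) setT).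
apply: ae_ge0_le_integral => //.
- by move=> t _; rewrite lee_fin prodr_ge0.
- apply/measurable_EFinP/measurable_prod => i _.
  by apply: measurableT_comp (measurable_tnth i) => //; exact: measurable_indic.
have : ae_eq (power_probability P1 a) setT F (cst 0%E).
  apply/ae_eq_integral_abs => //; rewrite -[RHS]dens0.
  by apply: eq_integral => t _; rewrite gee0_abs.
(* Where [F] vanishes, some coordinate lies outside its neighborhood, so the product of indicators
   vanishes too. If [F] vanished almost everywhere, this product would have integral zero. *)
apply: filterS => t /= /(_ I) Ft0 _.
have [/allP tU|/allPn[i _ tU]] := boolP (all (fun i => tnth t i \in U i) (enum 'I_a)).
  have : (0 < F t)%E.
    by apply: Fpos => i; apply/set_mem/tU; rewrite mem_enum.
  by rewrite Ft0 ltxx.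
by rewrite (bigD1 i) //= indicE (negPf tU) mul0r.
Qed.

End full_support.

End bigraphon_densities.

Lemma integral_le1 (R : realType) (d : measure_display) (T : measurableType d)
    (P : probability T R) (f : T -> \bar R) :
  measurable_fun setT f -> (forall x, 0 <= f x)%E -> (forall x, f x <= 1)%E ->
  (\int[P]_x f x <= 1)%E.
Proof.
move=> mf f0 f1; rewrite -[leRHS](probability_setT P) -[leRHS]mul1e.
by rewrite -integral_cst //; apply: ge0_le_integral.
Qed.

(** * Thinness as a vanishing density; passage to the product space *)

Section thin_bigraphons.
Context (R : realType) (d1 d2 : measure_display).
Context (J1 : measurableType d1) (J2 : measurableType d2).
Variables (P1 : probability J1 R) (P2 : probability J2 R) (W : J1 -> J2 -> R).
Hypothesis mW : measurable_fun setT (fun p : J1 * J2 => W p.1 p.2).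
Hypothesis W01 : forall x y, 0 <= W x y <= 1.

(** Tonelli; it carries a vanishing density over to the transposed bigraphon, so that results about
    [J1] also yield those about [J2]. *)
Lemma ordinal_density_swap (a b : nat) (E : 'I_a -> 'I_b -> bool) :
  ordinal_density P2 P1 (fun y x => W x y) (fun j i => E i j) =
  ordinal_density P1 P2 W E.
Proof.
rewrite /ordinal_density.
rewrite [RHS](fubini_tonelli (fun p : a.-tuple J1 * b.-tuple J2 =>
  (\prod_j \prod_i edge_weight (E i j) (W (tnth p.1 i) (tnth p.2 j)))%:E)).
- apply: eq_integral => y _; apply: eq_integral => x _.
  by rewrite exchange_big.
- exact: measurable_ordinal_integrand.
- by move=> p; exact: ordinal_integrand_ge0.
Qed.

(** [Rintegral] sends infinite values to 0, so a zero real density is informative only once both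
    integrals are known to be finite; the integrand lies in [[0, 1]], which bounds them by 1. *)
Lemma thin_ordinal_density : is_thin P1 P2 W ->
  exists a b, exists E : 'I_a -> 'I_b -> bool, ordinal_density P1 P2 W E = 0%E.
Proof.
move=> [F dF].
pose E (i : 'I_#|bigraph_left F|) (j : 'I_#|bigraph_right F|) :=
  (enum_val i, enum_val j) \in bigraph_edges F.
exists #|bigraph_left F|, #|bigraph_right F|, E.
have integrandE x y :
    (\prod_(e in bigraph_edges F)
        W (tnth x (enum_rank e.1)) (tnth y (enum_rank e.2))) *
    (\prod_(e in (~: bigraph_edges F)%SET)
        (1 - W (tnth x (enum_rank e.1)) (tnth y (enum_rank e.2)))) =
    \prod_j \prod_i edge_weight (E i j) (W (tnth x i) (tnth y j)).
  rewrite exchange_big pair_big /=.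
  rewrite (reindex (fun e : bigraph_left F * bigraph_right F =>
    (enum_rank e.1, enum_rank e.2))) /=; last first.
    exists (fun p => (enum_val p.1, enum_val p.2)) => [[u v] _|[i j] _] /=.
      by rewrite !enum_rankK.
    by rewrite !enum_valK.
  rewrite [RHS](bigID (mem (bigraph_edges F))) /=; congr (_ * _).
    apply: eq_bigr => -[u v] /= uv.
    by rewrite /E !enum_rankK uv.
  apply: eq_big => [e|[u v]]; rewrite inE // => /negPf uv.
  by rewrite /E !enum_rankK /= uv.
have colb x y :
    (0 <= (\prod_j \prod_i edge_weight (E i j) (W (tnth x i) (tnth y j)))%:E <= 1%:E)%E.
  rewrite !lee_fin prodr_ge0 => [|j _]; last first.
    by have /andP[] := column_itv W01 (tnth x) (E^~ j) (tnth y j).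
  by apply: prodr_ile1 => j _; exact: (column_itv W01 (tnth x) (E^~ j)).
have mcol x : measurable_fun setT (fun y : #|bigraph_right F|.-tuple J2 =>
    (\prod_j \prod_i edge_weight (E i j) (W (tnth x i) (tnth y j)))%:E).
  exact: measurable_fun_pair2 (measurable_ordinal_integrand mW E).
have inner0 x := integral_ge0 (power_probability P2 #|bigraph_right F|) (D := setT)
  (fun y _ => proj1 (andP (colb x y))).
have inner1 x : (\int[power_probability P2 #|bigraph_right F|]_y
    (\prod_j \prod_i edge_weight (E i j) (W (tnth x i) (tnth y j)))%:E <= 1)%E.
  by apply: integral_le1 => // y; have /andP[] := colb x y.
have dens0 : (0 <= ordinal_density P1 P2 W E)%E.
  by apply: integral_ge0 => x _; exact: inner0.
have dens1 : (ordinal_density P1 P2 W E <= 1)%E.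
  by apply: integral_le1 => //; exact: measurable_inner_density.
rewrite -[LHS]fineK; last by rewrite ge0_fin_numE // (le_lt_trans dens1) ?ltry.
congr _%:E; rewrite -[RHS]dF /ind_density /Rintegral; congr fine.
apply: eq_integral => x _; rewrite fineK.
  by apply: eq_integral => y _; rewrite integrandE.
under eq_integral do rewrite integrandE.
by rewrite ge0_fin_numE // (le_lt_trans (inner1 x)) ?ltry.
Qed.

(** Apply Tonelli to the nonnegative function [W (1 - W)], which vanishes exactly where [W] is 0 or
    1. *)
Lemma ae_bigraphon_01 :
    (forall x, {ae P2, forall y, W x y = 0 \/ W x y = 1}) ->
  {ae (P1 \x P2)%E, forall p : J1 * J2, W p.1 p.2 = 0 \/ W p.1 p.2 = 1}.
Proof.
move=> W01ae.
have mg : measurable_fun setT (fun p : J1 * J2 => W p.1 p.2 * (1 - W p.1 p.2)).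
  by apply: measurable_funM => //; exact: measurable_funB.
have g0 (p : J1 * J2) : 0 <= W p.1 p.2 * (1 - W p.1 p.2).
  by have /andP[? ?] := W01 p.1 p.2; rewrite mulr_ge0 // subr_ge0.
have : {ae (P1 \x P2)%E, forall p : J1 * J2, W p.1 p.2 * (1 - W p.1 p.2) = 0}.
  apply: ge0_ae_eq0 => //.
  rewrite (fubini_tonelli1 (fun p : J1 * J2 => (W p.1 p.2 * (1 - W p.1 p.2))%:E)).
  - rewrite -(integral0 P1 setT); apply: eq_integral => x _; rewrite /fubini_F /=.
    rewrite -(integral0 P2 setT); apply: ge0_ae_eq_integral => //.
    + exact: (measurable_fun_pair2 x (measurableT_comp (@EFin_measurable R setT) mg)).
    + by move=> y _; exact: (g0 (x, y)).
    + apply: filterS (W01ae x) => y + _ /=.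
      by move=> [->|->]; rewrite ?mul0r // subrr mulr0.
  - exact/measurable_EFinP.
  - by move=> p; rewrite lee_fin.
apply: filterS => p /eqP; rewrite mulf_eq0 subr_eq0 => /orP[/eqP->|/eqP<-].
  by left.
by right.
Qed.

(** * Null columns and the polynomial packing bound on one side *)

Section one_side.
Variables (a b : nat) (E : 'I_a -> 'I_b -> bool).
Hypothesis pureP : is_pure_side P1 (nbhd_dist1 P2 W).
Hypothesis density0 : ordinal_density P1 P2 W E = 0%E.

(** This holds for every tuple, not just almost every one, so it applies to constant tuples and to
    tuples of packing points. *)
Lemma exists_null_column (x : 'I_a -> J1) :
  exists j, column_density P2 W x (E^~ j) = 0%E.
Proof.
apply: contrapT => /forallNP nz.
have : (0 < ordinal_density P1 P2 W E)%E.
  apply: (ordinal_density_gt0 mW W01 pureP) => j.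
  by rewrite lt_neqAle column_density_ge0 // andbT eq_sym; apply/eqP/nz.
by rewrite density0 ltxx.
Qed.

Lemma ae_null_column (x : 'I_a -> J1) j : column_density P2 W x (E^~ j) = 0%E ->
  {ae P2, forall y, \prod_i edge_weight (E i j) (W (x i) y) = 0}.
Proof.
apply: ge0_ae_eq0; first exact: measurable_column.
by move=> y; have /andP[] := column_itv W01 x (E^~ j) y.
Qed.

Lemma ae_section_01 (x : J1) : {ae P2, forall y, W x y = 0 \/ W x y = 1}.
Proof.
have [j /ae_null_column] := exists_null_column (fun=> x).
apply: filterS => y /eqP; rewrite prodf_seq_eq0 => /hasP[i _ /=].
by case: (E i j); rewrite /edge_weight ?subr_eq0 => /eqP <-; [left|right].
Qed.

Lemma ln_packing_le (I : finType) (x : I -> J1) (e : R) :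
    0 < e -> e <= 1 -> (0 < #|I|)%N ->
    (forall i i', i != i' -> e <= nbhd_dist1 P2 W (x i) (x i')) ->
  ln #|I|%:R <= 1 + 2 * b.+1%:R * ln (4 * b.+1%:R) + 2 * b.+1%:R * ln 2 +
    2 * b.+1%:R * ln e^-1.
Proof.
move=> e0 e1 I0 sepx.
pose f i y := W (x i) y == 1.
(* Good points [y]: all rows are 0-1 valued there, and every null column over a tuple from the
   family vanishes there. These are finitely many almost sure conditions. *)
pose G y := (forall i, W (x i) y = 0 \/ W (x i) y = 1) /\
  (forall (t : {ffun 'I_a -> I}) j,
    column_density P2 W (fun i => x (t i)) (E^~ j) = 0%E ->
    \prod_i edge_weight (E i j) (W (x (t i)) y) = 0).
have aeG : {ae P2, forall y, G y}.
  have aeV : {ae P2, forall y i, W (x i) y = 0 \/ W (x i) y = 1}.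
    by apply: filter_forall => i; exact: ae_section_01.
  have aeN : {ae P2, forall y (t : {ffun 'I_a -> I}) j,
      column_density P2 W (fun i => x (t i)) (E^~ j) = 0%E ->
      \prod_i edge_weight (E i j) (W (x (t i)) y) = 0}.
    apply: filter_forall => t; apply: filter_forall => j.
    have [/ae_null_column|nz] :=
        pselect (column_density P2 W (fun i => x (t i)) (E^~ j) = 0%E).
      by apply: filterS => y + _.
    by apply: filterE => y /nz.
  by apply: filterS2 aeV aeN => y.
have sep (Q : {set I * I}) : (0 < #|Q|)%N -> (forall p, p \in Q -> p.1 != p.2) ->
    exists2 y, G y &
      e / 2 * #|Q|%:R <= #|[set p in Q | f p.1 y != f p.2 y]|%:R.
  (* Averaging: at a good [y] the sum below counts the pairs of [Q] separated by [y], and its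
     integral is at least [e] times the size of [Q]. It cannot stay below half of that at almost
     every [y]; the halving accounts for the term with [ln 2]. *)
  move=> Q0 Qd; apply: contrapT => noy.
  have : (\int[P2]_y (\sum_(p <- enum Q) `|W (x p.1) y - W (x p.2) y|%:E) <=
      \int[P2]_y (cst (e / 2 * #|Q|%:R)%:E y))%E.
    apply: ae_ge0_le_integral => //.
    - by move=> y _; apply: sume_ge0.
    - by apply: emeasurable_sum => p; exact/measurable_EFinP/measurable_dist.
    - by move=> y _; rewrite lee_fin mulr_ge0 // divr_ge0 // ltW.
    apply: filterS aeG => y Gy _; rewrite sumEFin lee_fin leNgt.
    apply/negP => lt; apply: noy; exists y => //; apply: ltW.
    apply: (lt_le_trans lt); rewrite big_enum /= -sum1_card natr_sum.
    rewrite [leRHS]big_mkcond [leLHS]big_mkcond /=; apply: ler_sum => p _.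
    rewrite inE; case: (p \in Q) => //=; rewrite /f.
    have [fG _] := Gy; case: (fG p.1) => ->; case: (fG p.2) => ->;
      rewrite ?eqxx ?(eq_sym 0) ?oner_eq0 /= ?subrr ?normr0 ?subr0 ?sub0r ?normrN ?normr1 //.
  apply/negP; rewrite -ltNge integral_cst // [X in (_ * X < _)%E]probability_setT mule1.
  rewrite ge0_integral_sum //; last by move=> p; exact/measurable_EFinP/measurable_dist.
  under eq_bigr do rewrite -nbhd_dist1E //.
  rewrite sumEFin lte_fin big_enum /=.
  apply: (@lt_le_trans _ _ (\sum_(p in Q) e)).
    by rewrite sumr_const -[ltRHS]mulr_natr ltr_pM2r ?ltr0n // ltr_pdivrMr //; lra.
  by apply: ler_sum => p /Qd; exact: sepx.
have e21 : e / 2 <= 1 by lra.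
have e20 : 0 < e / 2 by lra.
have lnE : ln (e / 2)^-1 = ln 2 + ln e^-1.
  by rewrite invf_div lnM ?posrE ?invr_gt0.
rewrite -addrA -mulrDr -lnE.
apply: ln_le_of_pow_bound => // k small.
have [s [sk sG leQ]] := greedy_separation e21 sep k.
rewrite leqNgt; apply/negP => big.
(* The number of unseparated pairs is a natural number below 1, hence zero. *)
have injs : {in [set: I]%SET &, injective (fun i => [seq f i y | y <- s])}.
  move=> i i' _ _ eqs; apply/eqP; apply: contraT => ii'.
  have := le_lt_trans leQ small; rewrite -[1]/(1%:R) ltr_nat ltnS leqn0 cards_eq0.
  move=> /eqP/setP/(_ (i, i')); rewrite !inE /= ii' /=.
  by move/eqP.
have [|t ts tE] := sauer_shelah_dual (b := b) injs.
  by rewrite cardsT; apply: leq_ltn_trans big; case: (b) => // n; rewrite leq_exp2r.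
have /all_sig[u uE] : forall i : 'I_a, {u : I | forall j, f u (t j) = E i j}.
  by move=> i; apply: cid; have [u _ uE] := tE (E i); exists u.
(* The shattered points provide rows [u] realizing the pattern [E], so at the good point [t j] every
   factor of column [j] is 1, although some column must vanish there. *)
have [j j0] := exists_null_column (fun i => x ([ffun i => u i] i)).
have [fG nG] := sG _ (ts j).
have /eqP := nG _ _ j0; rewrite prodf_seq_eq0 => /hasP[i _ /=].
rewrite ffunE; have := uE i j; rewrite /f.
by case: (fG (u i)) => ->; rewrite ?eqxx ?(eq_sym 0) ?oner_eq0 => <-;
  rewrite /edge_weight ?subr0 ?oner_eq0.
Qed.

Lemma pure_space_compact_dimension :
  compact [set: pure_space pureP] /\
  packing_dimension (pure_space pureP) \is a fin_num.
Proof.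
pose C : R := 1 + 2 * b.+1%:R * ln (4 * b.+1%:R) + 2 * b.+1%:R * ln 2.
have bd (e : R) (A : {fset pure_space pureP}) : 0 < e -> e <= 1 ->
    packing_separated e A -> (0 < #|` A|)%N -> ln #|` A|%:R <= C + 2 * b.+1%:R * ln e^-1.
  move=> e0 e1 sA; rewrite cardfE => A0.
  apply: (ln_packing_le (x := fun i : A => val i)) => // i i' ii'.
  by apply: (sA (val i) (val i') (fsvalP i) (fsvalP i')); rewrite (inj_eq val_inj).
split; last exact: (packing_dimension_fin_num (point : pure_space pureP) bd).
apply: finite_packing_compact; first exact: pure_complete pureP.
(* The packing bound covers only [e <= 1]; a set separated at a larger scale is also separated at
   scale 1. *)
move=> e e0; pose e' := Num.min e 1.
have e'0 : 0 < e' by rewrite lt_min e0 ltr01.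
exists (Num.truncn (expR (C + 2 * b.+1%:R * ln e'^-1))) => A sA.
have [->//|A0] := posnP #|` A|.
rewrite truncn_ge_nat ?expR_ge0 // -[leLHS]lnK ?posrE ?ltr0n // ler_expR.
apply: bd => //; first by rewrite ge_min lexx orbT.
by move=> x y xA yA xy; rewrite (le_trans _ (sA x y xA yA xy)) // ge_min lexx.
Qed.

End one_side.

End thin_bigraphons.

(** * Both sides together, by transposition *)

Theorem theorem4p1 (R : realType) (d1 d2 : measure_display)
    (J1 : measurableType d1) (J2 : measurableType d2)
    (P1 : probability J1 R) (P2 : probability J2 R) (W : J1 -> J2 -> R)
    (hW : is_bigraphon W) (hpure : is_pure P1 P2 W) (hthin : is_thin P1 P2 W) :
  [/\ {ae (P1 \x P2)%E, forall p : J1 * J2, W p.1 p.2 = 0 \/ W p.1 p.2 = 1},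
      compact [set: pure_space (pure_side1 hpure)] /\
      compact [set: pure_space (pure_side2 hpure)]
    & packing_dimension (pure_space (pure_side1 hpure)) \is a fin_num /\
      packing_dimension (pure_space (pure_side2 hpure)) \is a fin_num].
Proof.
have mW := bigraphon_measurable hW; have W01 := bigraphon_itv hW.
have [a [b [E density0]]] := thin_ordinal_density mW W01 hthin.
have mW' : measurable_fun setT (fun p : J2 * J1 => W p.2 p.1).
  exact: (measurableT_comp mW (measurable_swap (T1 := J2) (T2 := J1))).
have W01' y x : 0 <= W x y <= 1 by exact: W01.
have density0' := density0; rewrite -ordinal_density_swap // in density0'.
have [c1 p1] := pure_space_compact_dimension mW W01 (pure_side1 hpure) density0.
(* For the transposed function, [nbhd_dist1] is [nbhd_dist2] of [W] by conversion. *)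
have [c2 p2] := pure_space_compact_dimension (W := fun y x => W x y) mW' W01'
  (pure_side2 hpure) density0'.
split => //; apply: ae_bigraphon_01 => // x.
exact: (ae_section_01 mW W01 (pure_side1 hpure) density0).
Qed.
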